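(* Let $a>0$, $b>0$, $u\in(0,1)$ and $\eta\in[0,\min(a,S_\infty(a,b,u))]$. Let $B\sim\mathrm{Beta}(a,b)$. If $u>\frac{a-\eta}{a+b-\eta}$, then $$\log\mathbb P(B\ge u)-\log\mathbb P\left(B\ge\frac{a-\eta}{a+b-\eta}\right)\le-(a+b-\eta)\,\mathrm{kl}\left(\frac{a-\eta}{a+b-\eta},u\right).$$ In particular, for every $i\in\{0,1,2,\infty\}$, the choice $$\eta=\begin{cases}S_i(a,b,u)&\text{if }a\ge1,\\ a&\text{otherwise}\end{cases}$$ is admissible, i.e. it belongs to $[0,\min(a,S_\infty(a,b,u))]$.
   Context: $\mathrm{kl}(p,q)=p\log(p/q)+(1-p)\log((1-p)/(1-q))\in[0,\infty]$ for $p,q\in[0,1]$ (with $0\log0=0$). For $a,b>0$, $u\in(0,1)$, with $W_0$ the principal branch of the Lambert W function, $$S_\infty(a,b,u)=a-b\frac{u}{1-u}+\frac{W_0\left(\frac{b\,u^{\,a-b\frac{u}{1-u}}}{1-u}\log\frac1u\right)}{\log\frac1u},$$ and for $a\ge 1$, $$S_2(a,b,u)=a-b\left(b\log\tfrac1u+\tfrac1u-1\right)\frac{\sqrt{1+\frac{2(\frac1u-1)^2\log(\frac1u)(a-1)}{(b\log\frac1u+\frac1u-1)^2}}-1}{(\frac1u-1)^2},$$ $$S_1(a,b,u)=a-b\frac{a-1}{b+(\frac1u-1)/\log\frac1u},\qquad S_0(a,b,u)=a-b\frac{a-1}{b+1}.$$ *)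

(* Defs.v *)
From HB Require Import structures.
From mathcomp Require Import all_boot all_order all_algebra.
From mathcomp Require Import all_classical all_reals all_analysis.

Set Implicit Arguments.
Unset Strict Implicit.
Unset Printing Implicit Defensive.

Import Order.TTheory GRing.Theory Num.Theory.
Import numFieldNormedType.Exports.

Local Open Scope classical_set_scope.
Local Open Scope ring_scope.

(* The beta distribution of the library only has natural-number parameters;
   here the parameters are positive reals. The density is supported on the
   open interval ]0, 1[ because it may blow up at 0 or 1. *)
Definition rbeta_kernel (R : realType) (a b x : R) : R :=
  x `^ (a - 1) * (1 - x) `^ (b - 1).

Definition rbeta_fun (R : realType) (a b : R) : R :=
  \int[lebesgue_measure]_(x in `]0, 1[) rbeta_kernel a b x.

Definition rbeta_pdf (R : realType) (a b : R) : R -> R :=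
  (fun x => rbeta_kernel a b x / rbeta_fun a b) \_ `]0, 1[.

Definition has_beta_law (R : realType) (d : measure_display)
    (T : measurableType d) (P : probability T R) (B : {RV P >-> R})
    (a b : R) : Prop :=
  forall A : set R, measurable A ->
    distribution P B A = (\int[lebesgue_measure]_(x in A) (rbeta_pdf a b x)%:E)%E.

(* p log (p / q), with 0 log 0 = 0 (also when q = 0) and p log (p / 0) = +oo
   for p > 0. *)
Definition kl_term (R : realType) (p q : R) : \bar R :=
  if p == 0 then 0%E
  else if q == 0 then +oo%E
  else (p * ln (p / q))%:E.

Definition kl (R : realType) (p q : R) : \bar R :=
  (kl_term p q + kl_term (1 - p) (1 - q))%E.

(* For x >= - 1 / e, the equation w * e ^ w = x has exactly one solution
   w >= -1. Outside this domain the value is the default 0. *)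
Definition lambertW0 (R : realType) (x : R) : R :=
  xget 0 [set w : R | -1 <= w /\ w * expR w = x].

Definition Sinf (R : realType) (a b u : R) : R :=
  let c := a - b * (u / (1 - u)) in
  c + lambertW0 (b * u `^ c / (1 - u) * ln (1 / u)) / ln (1 / u).

Definition S2 (R : realType) (a b u : R) : R :=
  let m := b * ln (1 / u) + 1 / u - 1 in
  a - b * m *
    ((Num.sqrt (1 + 2 * (1 / u - 1) ^+ 2 * ln (1 / u) * (a - 1) / m ^+ 2) - 1)
     / (1 / u - 1) ^+ 2).

Definition S1 (R : realType) (a b u : R) : R :=
  a - b * ((a - 1) / (b + (1 / u - 1) / ln (1 / u))).

(* S0 does not depend on u; the argument is kept for uniformity. *)
Definition S0 (R : realType) (a b u : R) : R :=
  a - b * ((a - 1) / (b + 1)).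

Variant S_index := I0 | I1 | I2 | Iinf.

Definition S_of (R : realType) (i : S_index) : R -> R -> R -> R :=
  match i with
  | I0 => @S0 R
  | I1 => @S1 R
  | I2 => @S2 R
  | Iinf => @Sinf R
  end.

(* Main.v *)
Require Import Defs.
From HB Require Import structures.
From mathcomp Require Import all_boot all_order all_algebra.
From mathcomp Require Import ring lra.
From mathcomp Require Import all_classical all_reals all_analysis.
From mathcomp Require Import measurable_realfun.

Set Implicit Arguments.
Unset Strict Implicit.
Unset Printing Implicit Defensive.

Import Order.TTheory GRing.Theory Num.Theory.
Import numFieldNormedType.Exports.

Local Open Scope classical_set_scope.
Local Open Scope ring_scope.

(** Write H for the upper tail of the Beta law, c for its normalising constant,
    and h(x) = ln (H x) - (a - eta) ln x - b ln (1 - x). With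
    p = (a - eta) / (a + b - eta), the products of a + b - eta with p and with
    1 - p are a - eta and b, so the inequality to prove is exactly
    h(u) <= h(p).

    The derivative of h is (eta - eta_c(x)) / x, where eta_c(x), called
    [critical_eta] below, is given by
      M(x) = b x - (a - eta_c(x)) (1 - x),   M(x) = c x^a (1 - x)^b / H(x).
    It is therefore enough that eta <= eta_c on ]0, u].

    If a <= 1 this holds because eta <= a <= eta_c ([critical_eta_ge_a]).

    If a >= 1, two facts are combined. First, eta_c is nonincreasing
    ([critical_eta_nonincreasing]). Otherwise, freezing eta_c at a point where
    it increases gives an explicit competitor
      c x^a (1 - x)^b / (b x - (a - eta_c) (1 - x))
    of H, which agrees with H at that point and whose difference with H is
    strictly increasing from there on although it does not become positive
    at 1. Second, eta_c(u) >= S_infinity ([Sinf_le_critical_eta]): since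
    x (ln M)' = eta_c and M tends to b at 1, the monotonicity of eta_c yields
    M(u) >= b u^eta_c(u) ([hazard_ge]), that is
      b u - (a - e) (1 - u) >= b u^e   for e = eta_c(u),
    while S_infinity is the root of the corresponding equation
    ([eta_defect_Sinf]), whose two sides differ by an increasing function
    of e. Hence eta <= S_infinity <= eta_c(u) <= eta_c(x) for x <= u.

    The same monotone equation decides whether S_0, S_1 and S_2 are below
    S_infinity: each reduces to an elementary bound on 1 - u^(S_i - 1). For
    S_0 and S_1 it is 1 - exp (- y) <= y, and for S_2 it is the second-order
    bound 1 - exp (- (y + y^2 / 2)) <= y. *)

(** * Monotone functions on an interval ending at 1 *)

Lemma is_derive_mean_value (R : realType) (f f' : R -> R) (x y : R) :
  x < y -> (forall z, x <= z <= y -> is_derive z 1 f (f' z)) ->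
  exists2 z, x < z < y & f y - f x = f' z * (y - x).
Proof.
move=> xy fE; have [z zxy|z zxy|z /[!in_itv]/= zxy ->] := @MVT _ f f' x y xy.
- by apply: fE; rewrite !ltW ?(itvP zxy).
- apply: (@derivable_within_continuous _ _ f `[x, y]) zxy => {}z.
  by rewrite in_itv/= => /fE.
- by exists z.
Qed.

Lemma ler_is_derive (R : realType) (f f' : R -> R) (x y : R) :
  (forall z, x <= z <= y -> is_derive z 1 f (f' z)) ->
  (forall z, x < z < y -> f' z <= 0) -> x <= y -> f y <= f x.
Proof.
move=> fE f'le0; rewrite le_eqVlt => /predU1P[->//|xy].
have [z zxy fyx] := is_derive_mean_value xy fE.
by rewrite -subr_le0 fyx mulr_le0_ge0 ?f'le0// subr_ge0 ltW.
Qed.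

(** A one-sided asymptotic bound at 1 is all that is available for the functions
    compared below, so no limit is required: it suffices that f is eventually
    above every negative number. *)
Lemma nonincreasing_ge0 (R : realType) (f f' : R -> R) (x : R) : x < 1 ->
  (forall z, x <= z < 1 -> is_derive z 1 f (f' z)) ->
  (forall z, x < z < 1 -> f' z <= 0) ->
  (forall e, 0 < e -> \forall y \near 1^'-, - e < f y) -> 0 <= f x.
Proof.
move=> x1 fE f'le0 flim; rewrite leNgt; apply/negP => fx0.
have e0 : 0 < - f x by rewrite oppr_gt0.
have [y [[xy y1] fxy]] : exists y, (x <= y /\ y < 1) /\ - - f x < f y.
  apply: (@filter_ex _ (1^'-)); near=> y; split; last first.
    by near: y; exact: flim.
  by split; near: y; [exact: nbhs_left_ge|exact: nbhs_left_lt].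
rewrite opprK in fxy; move: fxy; rewrite ltNge => /negP; apply.
apply: (ler_is_derive (f' := f')) => // z /andP[xz zy].
  by apply: fE; rewrite xz (le_lt_trans zy).
by apply: f'le0; rewrite xz (lt_trans zy).
Unshelve. all: by end_near. Qed.

Lemma decreasing_gt0 (R : realType) (f f' : R -> R) (x : R) : x < 1 ->
  (forall z, x <= z < 1 -> is_derive z 1 f (f' z)) ->
  (forall z, x < z < 1 -> f' z < 0) ->
  (forall e, 0 < e -> \forall y \near 1^'-, - e < f y) -> 0 < f x.
Proof.
move=> x1 fE f'lt0 flim; pose y := (x + 1) / 2.
have xy : x < y by rewrite /y; lra.
have y1 : y < 1 by rewrite /y; lra.
have fy : 0 <= f y.
  apply: (nonincreasing_ge0 (f' := f') y1) => // z /andP[yz z1].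
    by apply: fE; rewrite z1 (le_trans (ltW xy)).
  by rewrite ltW// f'lt0// z1 (lt_trans xy).
have [z /andP[xz zy] fyx] : exists2 z, x < z < y & f y - f x = f' z * (y - x).
  apply: is_derive_mean_value => // z /andP[xz zy].
  by apply: fE; rewrite xz (le_lt_trans zy).
rewrite (le_lt_trans fy)// -subr_lt0 fyx nmulr_rlt0 ?subr_gt0//.
by rewrite f'lt0// xz (lt_trans zy).
Qed.

Lemma near1_itv (R : realType) (x : R) :
  x < 1 -> \forall y \near (1 : R)^'-, x < y /\ y < 1.
Proof.
move=> x1; near=> y; split; near: y; [exact: nbhs_left_gt|exact: nbhs_left_lt].
Unshelve. all: by end_near. Qed.

(** * The kernel of the Beta law *)

Section beta_kernel.
Context {R : realType}.
Implicit Types a b c x e : R.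

Lemma is_derive_onem x : is_derive x 1 (fun y : R => 1 - y) (- 1).
Proof.
by rewrite -[- 1]sub0r; exact: is_deriveB.
Qed.

Lemma is_derive_onem_powR b x : x < 1 ->
  is_derive x 1 (fun y => (1 - y) `^ b) (- (b * (1 - x) `^ (b - 1))).
Proof.
move=> x1.
have x10 : 0 < 1 - x by rewrite subr_gt0.
have := is_derive1_comp (f := fun y : R => y `^ b) (g := fun y : R => 1 - y)
  (is_derive1_powR b x10) (is_derive_onem x).
by rewrite mulrN1.
Qed.

Lemma powRB1 a x : 0 < x -> x `^ (a - 1) = x `^ a / x.
Proof.
by move=> x0; rewrite powRB ?(gt_eqF x0) ?implybT// powRr1// ltW.
Qed.

Lemma is_derive_rbeta_kernel a b x : 0 < x -> x < 1 ->
  is_derive x 1 (rbeta_kernel a b)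
    (rbeta_kernel a b x * ((a - 1) / x - (b - 1) / (1 - x))).
Proof.
move=> x0 x1.
have x10 : 0 < 1 - x by rewrite subr_gt0.
have := is_deriveM (is_derive1_powR (a - 1) x0)
  (is_derive_onem_powR (b - 1) x1).
move=> /is_derive_eq; apply.
rewrite /rbeta_kernel /GRing.scale/= [x `^ (_ - 1 - 1)]powRB1//.
rewrite [(1 - x) `^ (_ - 1 - 1)]powRB1//.
by ring.
Qed.

Lemma rbeta_kernel_gt0 a b x : 0 < x -> x < 1 -> 0 < rbeta_kernel a b x.
Proof. by move=> x0 x1; rewrite mulr_gt0// powR_gt0// subr_gt0. Qed.

Lemma rbeta_kernelSl a b x : 0 < x ->
  rbeta_kernel (a + 1) b x = x * rbeta_kernel a b x.
Proof.
move=> x0; rewrite /rbeta_kernel addrK (powRB1 _ x0); field.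
by rewrite gt_eqF.
Qed.

Lemma rbeta_kernelSr a b x : x < 1 ->
  rbeta_kernel a (b + 1) x = (1 - x) * rbeta_kernel a b x.
Proof.
rewrite -subr_gt0 => x1.
rewrite /rbeta_kernel addrK (powRB1 _ x1); field.
by rewrite gt_eqF.
Qed.

Lemma onem_powR_cvg0 b : 0 < b -> (1 - x) `^ b @[x --> (1 : R)^'-] --> (0 : R).
Proof.
move=> b0; apply/cvgrPdist_lt => e e0; near=> x.
have x1 : 0 < 1 - x by rewrite subr_gt0; near: x; exact: nbhs_left_lt.
rewrite sub0r normrN ger0_norm ?powR_ge0//.
have <- : (e `^ b^-1) `^ b = e by rewrite -powRrM mulVf ?gt_eqF// powRr1// ltW.
apply: gt0_ltr_powR; rewrite ?nnegrE ?powR_ge0 ?ltW//.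
by near: x; apply: nbhs_left_ltBl; exact: powR_gt0.
Unshelve. all: by end_near. Qed.

Lemma onem_powR_near_lt c b e : 0 < c -> 0 < b -> 0 < e ->
  \forall y \near (1 : R)^'-, c * (1 - y) `^ b < e.
Proof.
move=> c0 b0 e0; have /cvgrPdist_lt/(_ (e / c)) := onem_powR_cvg0 b0.
rewrite divr_gt0// => /(_ isT); apply: filterS => y.
by rewrite sub0r normrN ger0_norm ?powR_ge0// ltr_pdivlMr// mulrC.
Qed.

End beta_kernel.

(** * The hazard of a Beta tail *)

(** The two properties of the upper tail of a law with density c times the
    kernel on ]0, 1[ that make it a solution, determined by its value at 1, of a
    first-order differential equation on ]0, 1[. *)
Definition beta_tail (R : realType) (c a b : R) (H : R -> R) :=
  (forall x : R, 0 < x -> x < 1 ->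
    is_derive x 1 H (- (c * rbeta_kernel a b x))) /\
  H x @[x --> (1 : R)^'-] --> (0 : R).

Section beta_tail.
Context {R : realType} (c a b : R) (H : R -> R).
Context (c_gt0 : 0 < c) (b_gt0 : 0 < b) (tailH : beta_tail c a b H).
Implicit Types x e : R.

Let k := rbeta_kernel a b.

Let k_gt0 x : 0 < x -> x < 1 -> 0 < k x.
Proof. exact: rbeta_kernel_gt0. Qed.

Let weight_gt0 x : 0 < x -> x < 1 -> 0 < c * (1 - x) * k x / x.
Proof.
by move=> x0 x1; rewrite divr_gt0// mulr_gt0 ?k_gt0// mulr_gt0// subr_gt0.
Qed.

Lemma beta_tail_near_norm e : 0 < e -> \forall y \near (1 : R)^'-, `|H y| < e.
Proof.
move=> e0; have [_ /cvgrPdist_lt/(_ e e0)] := tailH.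
by apply: filterS => y; rewrite sub0r normrN.
Qed.

Lemma beta_tail_gt0 x : 0 < x -> x < 1 -> 0 < H x.
Proof.
move=> x0 x1; apply: (decreasing_gt0 (f' := fun y => - (c * k y))) => //.
- move=> y /andP[xy y1]; have [+ _] := tailH; apply => //.
  exact: lt_le_trans xy.
- move=> y /andP[xy y1]; rewrite oppr_lt0 mulr_gt0// k_gt0//.
  exact: lt_trans xy.
- move=> e /beta_tail_near_norm; apply: filterS => y.
  by rewrite ltr_norml => /andP[].
Qed.

Let H_neq0 x : 0 < x -> x < 1 -> H x != 0.
Proof. by move=> x0 x1; rewrite gt_eqF ?beta_tail_gt0. Qed.

(* Integration by parts in differential form: the boundary term
   c x^(a-1) (1-x)^b differs from b H by an integral with the sign of a - 1. *)
Let is_derive_parts x : 0 < x -> x < 1 ->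
  is_derive x 1 (fun y : R => b * H y - c * rbeta_kernel a (b + 1) y)
    (- (a - 1) * (c * (1 - x) * k x / x)).
Proof.
move=> x0 x1; have [/(_ x x0 x1) dH _] := tailH.
have := is_deriveB (is_deriveZ b dH)
  (is_deriveZ c (is_derive_rbeta_kernel a (b + 1) x0 x1)).
move/is_derive_eq; apply; rewrite /GRing.scale/= rbeta_kernelSr// -/k; field.
by rewrite gt_eqF// gt_eqF// subr_gt0.
Qed.

Lemma beta_tail_ge x : 1 <= a -> 0 < x -> x < 1 ->
  c * rbeta_kernel a (b + 1) x <= b * H x.
Proof.
move=> a1 x0 x1; rewrite -subr_ge0.
apply: (nonincreasing_ge0 x1
  (f := fun y => b * H y - c * rbeta_kernel a (b + 1) y)
  (f' := fun y => - (a - 1) * (c * (1 - y) * k y / y))).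
- move=> y /andP[xy y1]; apply: is_derive_parts => //.
  exact: lt_le_trans xy.
- move=> y /andP[xy y1]; have y0 := lt_trans x0 xy.
  by rewrite mulNr oppr_le0 mulr_ge0 ?subr_ge0// ltW// weight_gt0.
- move=> e e0; near=> y.
  have [y0 y1] : 0 < y /\ y < 1 by near: y; exact: near1_itv.
  have cye : c * (1 - y) `^ b < e by near: y; exact: onem_powR_near_lt.
  have bH0 : 0 <= b * H y by rewrite mulr_ge0 ?ltW ?beta_tail_gt0.
  rewrite ltrBrDr -ltrBrDl opprK (le_lt_trans _ (ltr_wpDl bH0 cye))//.
  rewrite ler_pM2l// /rbeta_kernel addrK ler_piMl ?powR_ge0//.
  rewrite -[leRHS](powRr0 y).
  by apply: ger_powR; rewrite ?subr_ge0// y0 ltW.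
Unshelve. all: by end_near. Qed.

Lemma beta_tail_le x : a <= 1 -> 0 < x -> x < 1 ->
  b * H x <= c * rbeta_kernel a (b + 1) x.
Proof.
move=> a1 x0 x1; rewrite -subr_le0 -oppr_ge0.
apply: (nonincreasing_ge0 x1
  (f := fun y => - (b * H y - c * rbeta_kernel a (b + 1) y))
  (f' := fun y => - (- (a - 1) * (c * (1 - y) * k y / y)))).
- move=> y /andP[xy y1]; apply: is_deriveN.
  by apply: is_derive_parts => //; exact: lt_le_trans xy.
- move=> y /andP[xy y1]; have y0 := lt_trans x0 xy.
  by rewrite mulNr opprK mulr_le0_ge0 ?subr_le0// ltW// weight_gt0.
- move=> e e0; near=> y.
  have [y0 y1] : 0 < y /\ y < 1 by near: y; exact: near1_itv.
  have : `|H y| < e / b.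
    by near: y; apply: beta_tail_near_norm; rewrite divr_gt0.
  rewrite ltr_pdivlMr// gtr0_norm ?beta_tail_gt0// => He.
  have : 0 < c * rbeta_kernel a (b + 1) y by rewrite mulr_gt0 ?rbeta_kernel_gt0.
  by lra.
Unshelve. all: by end_near. Qed.

Lemma beta_tail_le_onem x : 1 <= a -> 0 < x -> x < 1 ->
  b * H x <= c * (1 - x) `^ b.
Proof.
move=> a1 x0 x1; rewrite -subr_ge0.
apply: (nonincreasing_ge0 x1 (f := fun y => c * (1 - y) `^ b - b * H y)
  (f' := fun y => b * c * ((y `^ (a - 1) - 1) * (1 - y) `^ (b - 1)))).
- move=> y /andP[xy y1]; have y0 := lt_le_trans x0 xy.
  have [/(_ y y0 y1) dH _] := tailH.
  have := is_deriveB (is_deriveZ c (is_derive_onem_powR b y1))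
    (is_deriveZ b dH).
  by move/is_derive_eq; apply; rewrite /GRing.scale/= /rbeta_kernel; ring.
- move=> y /andP[xy y1]; have y0 := lt_trans x0 xy.
  apply: mulr_ge0_le0; first by rewrite ltW// mulr_gt0.
  apply: mulr_le0_ge0; last exact: powR_ge0.
  rewrite subr_le0.
  rewrite -[leRHS](powRr0 y).
  by apply: ger_powR; rewrite ?subr_ge0// y0 ltW.
- move=> e e0; near=> y.
  have : `|H y| < e / b.
    by near: y; apply: beta_tail_near_norm; rewrite divr_gt0.
  rewrite ltr_pdivlMr// => He.
  have : H y * b <= `|H y| * b by rewrite ler_pM2r// ler_norm.
  have : 0 <= c * (1 - y) `^ b by rewrite mulr_ge0 ?powR_ge0// ltW.
  by lra.
Unshelve. all: by end_near. Qed.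

(** The hazard rate density / tail, multiplied by x (1 - x); this normalisation
    makes it tend to b at 1. *)
Definition hazard x := c * rbeta_kernel (a + 1) (b + 1) x / H x.

(** The value of eta at which ln H - (a - eta) ln - b ln (1 - .) is stationary
    at x; it is also x times the logarithmic derivative of the hazard. *)
Definition critical_eta x := a - (b * x - hazard x) / (1 - x).

Lemma hazardE x : x < 1 -> hazard x = b * x - (a - critical_eta x) * (1 - x).
Proof.
rewrite -subr_gt0 => x1; rewrite /critical_eta; field.
by rewrite gt_eqF.
Qed.

Lemma hazard_gt0 x : 0 < x -> x < 1 -> 0 < hazard x.
Proof.
by move=> x0 x1; rewrite divr_gt0 ?beta_tail_gt0// mulr_gt0 ?rbeta_kernel_gt0.
Qed.

Lemma is_derive_hazard x : 0 < x -> x < 1 ->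
  is_derive x 1 hazard (hazard x * (critical_eta x / x)).
Proof.
move=> x0 x1; have [/(_ x x0 x1) dH _] := tailH.
have := is_deriveM
  (is_deriveZ c (is_derive_rbeta_kernel (a + 1) (b + 1) x0 x1))
  (is_deriveV (H_neq0 x0 x1) dH).
move/is_derive_eq; apply; rewrite /critical_eta /hazard /= /GRing.scale/=.
rewrite rbeta_kernelSl// rbeta_kernelSr// -/k; field.
by rewrite H_neq0// gt_eqF// gt_eqF// subr_gt0.
Qed.

(** Together with [is_derive_hazard], this is a Riccati equation in disguise: by
    [hazardE] the numerator is a quadratic polynomial in eta. *)
Lemma is_derive_critical_eta x : 0 < x -> x < 1 ->
  is_derive x 1 critical_eta
    ((critical_eta x * hazard x / x - (a + b - critical_eta x)) / (1 - x)).
Proof.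
move=> x0 x1; have x10 : 1 - x != 0 by rewrite gt_eqF ?subr_gt0.
have := is_deriveB (is_derive_cst a x 1) (is_deriveM
  (is_deriveB (is_deriveZ b (is_derive_id x 1)) (is_derive_hazard x0 x1))
  (is_deriveV (f := fun y : R => 1 - y) x10 (is_derive_onem x))).
move/is_derive_eq; apply; rewrite /= /GRing.scale/= hazardE//.
rewrite -[(_ - hazard) x]/(b * x - hazard x) /critical_eta; field.
by rewrite x10 gt_eqF.
Qed.

End beta_tail.

(** * Monotonicity of the critical value of eta *)

Section critical_eta.
Context {R : realType} (c a b : R) (H : R -> R).
Context (c_gt0 : 0 < c) (b_gt0 : 0 < b) (tailH : beta_tail c a b H).
Implicit Types x y e : R.

Let M := hazard c a b H.
Let E := critical_eta c a b H.

Lemma critical_eta_le_a x : 1 <= a -> 0 < x -> x < 1 -> E x <= a.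
Proof.
move=> a1 x0 x1; rewrite /E /critical_eta gerBl divr_ge0 ?subr_ge0 ?(ltW x1)//.
rewrite ler_pdivrMr ?(beta_tail_gt0 c_gt0 tailH)// rbeta_kernelSl// mulrCA.
rewrite [b * x]mulrC -mulrA ler_pM2l//.
exact: (beta_tail_ge c_gt0 b_gt0 tailH).
Qed.

Lemma critical_eta_ge_a x : a <= 1 -> 0 < x -> x < 1 -> a <= E x.
Proof.
move=> a1 x0 x1; rewrite /E /critical_eta lerBrDr gerDl.
rewrite mulr_le0_ge0 ?invr_ge0 ?subr_ge0 ?(ltW x1)//.
rewrite subr_le0 ler_pdivlMr ?(beta_tail_gt0 c_gt0 tailH)// rbeta_kernelSl//.
rewrite mulrCA [b * x]mulrC -mulrA ler_pM2l//.
exact: (beta_tail_le c_gt0 b_gt0 tailH).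
Qed.

(** If the slope were positive at x, freeze e at its value there. With
    D y = b y - (a - e) (1 - y), the function c y^a (1 - y)^b / D y equals H
    at x, and the sign of the derivative of its difference with H is that of
    e * D y - (a + b - e) * y, which is positive on [x, 1[ once it is at x.
    So H minus this function is decreasing from 0 while its lower limit at 1 is
    nonnegative, a contradiction. *)
Lemma critical_eta_slope_le0 x : 1 <= a -> 0 < x -> x < 1 ->
  E x * M x / x - (a + b - E x) <= 0.
Proof.
move=> a1 x0 x1; rewrite leNgt; apply/negP.
have Mx := hazardE c a b H x1.
have Mx0 := hazard_gt0 c_gt0 tailH x0 x1.
have Ea := critical_eta_le_a a1 x0 x1.
rewrite /E /M in Ea *.
set e := critical_eta _ _ _ _ _ in Mx Ea *; clearbody e; pose n := a + b - e.
have n0 : 0 < n by move: b_gt0; rewrite /n; lra.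
pose D y := n * y - (a - e).
have DxM : D x = hazard c a b H x by rewrite Mx /D /n; ring.
rewrite -DxM subr_gt0 ltr_pdivlMr// -/n => Qx.
(* e * D y - n * y = (e - 1) * n * y - e * (a - e): positivity at x forces
   e > 1, and then the expression increases with y. *)
have e1 : 1 < e.
  have : 0 < (e - 1) * (n * x) - e * (a - e) by move: Qx; rewrite /D; lra.
  rewrite -DxM in Mx0.
  have e0 : 0 < e by rewrite -(pmulr_lgt0 _ Mx0) (lt_trans _ Qx)// mulr_gt0.
  have : 0 <= e * (a - e) by rewrite mulr_ge0 ?subr_ge0// ltW.
  move=> p1 p2; have : 0 < (e - 1) * (n * x) by lra.
  by rewrite pmulr_lgt0 ?mulr_gt0// subr_gt0.
have D_gt0 y : x <= y -> 0 < D y.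
  move=> xy; rewrite (@lt_le_trans _ _ (D x)) ?DxM// -DxM /D lerB//.
  by rewrite ler_pM2l.
have Q_gt0 y : x <= y -> 0 < e * D y - n * y.
  move=> xy; rewrite (@lt_le_trans _ _ (e * D x - n * x)) ?subr_gt0//.
  rewrite -subr_ge0 (_ : _ - _ = (e - 1) * (n * (y - x))); last first.
    by rewrite /D; ring.
  by rewrite !mulr_ge0 ?(ltW n0) ?subr_ge0 ?(ltW e1).
pose f y := H y - c * rbeta_kernel (a + 1) (b + 1) y / D y.
suff : 0 < f x.
  rewrite /f DxM /hazard invf_div mulrCA divff ?mulr1 ?subrr ?ltxx//.
  by rewrite gt_eqF// mulr_gt0// rbeta_kernel_gt0.
have dD y : is_derive y 1 D n.
  have := is_deriveB (is_deriveZ n (is_derive_id y 1))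
    (is_derive_cst (a - e) y 1).
  by move/is_derive_eq; apply; rewrite subr0 /GRing.scale/= mulr1.
apply: (decreasing_gt0 (f' := fun y =>
  - (c * rbeta_kernel a b y * (1 - y) * (e * D y - n * y) / D y ^+ 2))) => //.
- move=> y /andP[xy y1]; have y0 := lt_le_trans x0 xy.
  have Dy0 : D y != 0 by rewrite gt_eqF ?D_gt0.
  have [/(_ y y0 y1) dH _] := tailH.
  have := is_deriveB dH (is_deriveM
    (is_deriveZ c (is_derive_rbeta_kernel (a + 1) (b + 1) y0 y1))
    (is_deriveV Dy0 (dD y))).
  move/is_derive_eq; apply; rewrite /= /GRing.scale/=.
  rewrite rbeta_kernelSl// rbeta_kernelSr// /D /n; field.
  by rewrite -/n -/(D y) Dy0 !gt_eqF ?subr_gt0.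
- move=> y /andP[xy y1]; have y0 := lt_trans x0 xy.
  rewrite oppr_lt0 divr_gt0 ?exprn_gt0 ?D_gt0 ?(ltW xy)//.
  rewrite mulr_gt0 ?Q_gt0 ?(ltW xy)// mulr_gt0 ?subr_gt0// mulr_gt0//.
  exact: rbeta_kernel_gt0.
- move=> d d0; near=> y.
  have [xy y1] : x < y /\ y < 1 by near: y; exact: near1_itv.
  have y0 := lt_trans x0 xy; have Hy := beta_tail_gt0 c_gt0 tailH y0 y1.
  suff : c * rbeta_kernel (a + 1) (b + 1) y / D y < d by rewrite /f; lra.
  rewrite ltr_pdivrMr ?D_gt0 ?(ltW xy)//.
  have cy : c * (1 - y) `^ b < d * D x.
    by near: y; apply: onem_powR_near_lt => //; rewrite mulr_gt0 ?D_gt0.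
  rewrite (@le_lt_trans _ _ (c * (1 - y) `^ b))//.
    rewrite ler_pM2l// /rbeta_kernel !addrK ler_piMl ?powR_ge0//.
    by rewrite -[leRHS](powRr0 y) ger_powR// ?y0 ?ltW//; lra.
  rewrite (lt_le_trans cy)// ler_pM2l// /D lerB// ler_pM2l// ltW//.
Unshelve. all: by end_near. Qed.

Lemma critical_eta_nonincreasing x y : 1 <= a -> 0 < x -> y < 1 -> x <= y ->
  E y <= E x.
Proof.
move=> a1 x0 y1; apply: (ler_is_derive (f := E) (f' := fun z =>
  (E z * M z / z - (a + b - E z)) / (1 - z))) => z /andP[xz zy].
  apply: (is_derive_critical_eta c_gt0 tailH); first exact: lt_le_trans xz.
  exact: le_lt_trans y1.
have z0 := lt_trans x0 xz; have z1 := lt_trans zy y1.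
rewrite mulr_le0_ge0 ?invr_ge0 ?subr_ge0 ?(ltW z1)//.
exact: critical_eta_slope_le0.
Qed.

(** With e frozen at its value at x, the logarithmic derivative of
    M y * y^(- e) is (eta_c(y) - e) / y <= 0, so the value at x dominates the
    limit at 1, which is b. *)
Lemma hazard_ge x : 1 <= a -> 0 < x -> x < 1 -> b * x `^ E x <= M x.
Proof.
move=> a1 x0 x1; have Ea := critical_eta_le_a a1 x0 x1.
set e := E x in Ea *.
suff : 0 <= M x * x `^ (- e) - b.
  by rewrite subr_ge0 powRN ler_pdivlMr ?powR_gt0.
apply: (nonincreasing_ge0 x1 (f := fun y => M y * y `^ (- e) - b)
  (f' := fun y => M y * y `^ (- e) / y * (E y - e))).
- move=> y /andP[xy y1]; have y0 := lt_le_trans x0 xy.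
  have := is_deriveB (is_deriveM (is_derive_hazard c_gt0 tailH y0 y1)
    (is_derive1_powR (- e) y0)) (is_derive_cst b y 1).
  move/is_derive_eq; apply; rewrite /= /GRing.scale/= -/(M y) -/(E y).
  by rewrite (powRB1 _ y0); field; rewrite gt_eqF.
- move=> y /andP[xy y1]; have y0 := lt_trans x0 xy.
  apply: mulr_ge0_le0.
    rewrite divr_ge0 1?ltW// mulr_gt0 ?powR_gt0//.
    exact: (hazard_gt0 c_gt0 tailH).
  by rewrite subr_le0 critical_eta_nonincreasing// ltW.
- move=> d d0; near=> y.
  have [xy y1] : x < y /\ y < 1 by near: y; exact: near1_itv.
  have y0 := lt_trans x0 xy; have Hy := beta_tail_gt0 c_gt0 tailH y0 y1.
  have My : b * y `^ a <= M y.
    rewrite /M /hazard ler_pdivlMr// /rbeta_kernel !addrK mulrAC mulrC.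
    rewrite [leRHS]mulrCA ler_pM2l ?powR_gt0//.
    exact: (beta_tail_le_onem c_gt0 b_gt0 tailH).
  have : b * y `^ (a - e) <= M y * y `^ (- e).
    rewrite powRD ?(gt_eqF y0) ?implybT// mulrA.
    by rewrite ler_pM2r ?powR_gt0.
  suff : b - d < b * y `^ (a - e) by lra.
  have : `|1 - y `^ (a - e)| < d / b.
    near: y; have : {for (1 : R), continuous (fun y => y `^ (a - e))}.
      have [+ _] := is_derive1_powR (a - e) (@ltr01 R).
      by move=> /derivable1_diffP/differentiable_continuous.
    move/cvg_at_left_filter; rewrite powR1 => /cvgrPdist_lt; apply.
    exact: divr_gt0.
  rewrite ltr_pdivlMr// => yd; have := ler_norm (1 - y `^ (a - e)).
  by move: b_gt0; nra.
Unshelve. all: by end_near. Qed.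

(** The derivative of ln H - (a - e) ln - b ln (1 - .) is (e - eta_c) / x. *)
Lemma beta_tail_ln_le e x y : 0 < x -> y < 1 -> x <= y ->
  (forall z, 0 < z -> z <= y -> e <= E z) ->
  ln (H y) - ln (H x)
    <= (a - e) * (ln y - ln x) + b * (ln (1 - y) - ln (1 - x)).
Proof.
move=> x0 y1 xy eE.
pose f z := ln (H z) - (a - e) * ln z - b * ln (1 - z).
suff : f y <= f x by rewrite /f; lra.
apply: (ler_is_derive (f' := fun z => (e - E z) / z)) xy => z /andP[xz zy].
  have z0 := lt_le_trans x0 xz; have z1 := le_lt_trans zy y1.
  have [/(_ z z0 z1) dH _] := tailH.
  have Hz := beta_tail_gt0 c_gt0 tailH z0 z1.
  have z10 : 0 < 1 - z by rewrite subr_gt0.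
  have := is_deriveB (is_deriveB
    (is_derive1_comp (f := @ln R) (is_derive1_ln Hz) dH)
    (is_deriveZ (a - e) (is_derive1_ln z0)))
    (is_deriveZ b (is_derive1_comp (f := @ln R) (g := fun y : R => 1 - y)
       (is_derive1_ln z10) (is_derive_onem z))).
  move/is_derive_eq; apply; rewrite /= /GRing.scale/= /E /critical_eta /hazard.
  rewrite rbeta_kernelSl// rbeta_kernelSr//; field.
  by rewrite !gt_eqF.
have z0 := lt_trans x0 xz.
by rewrite mulr_le0_ge0 ?invr_ge0 ?(ltW z0)// subr_le0 eE// ltW.
Qed.

End critical_eta.

(** * The threshold S_infinity and its lower bounds *)

Section threshold.
Context {R : realType}.
Implicit Types a b u e w x y : R.

Lemma lambertW0K y : 0 < y -> lambertW0 y * expR (lambertW0 y) = y.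
Proof.
move=> y0; pose f w := w * expR w - y.
have cf : {within `[0, y], continuous f}.
  apply: continuous_subspaceT => w; apply: cvgB; last exact: cvg_cst.
  by apply: cvgM; [exact: cvg_id|exact: continuous_expR].
have f0y : Num.min (f 0) (f y) <= 0 <= Num.max (f 0) (f y).
  rewrite ge_min le_max /f mul0r sub0r oppr_le0 ltW//= subr_ge0.
  by apply/orP; right; rewrite ler_peMr ?(ltW y0)// -[leLHS]expR0 ler_expR ltW.
have [w /[!in_itv]/= /andP[w0 wy] /eqP] := IVT (ltW y0) cf f0y.
rewrite subr_eq0 => /eqP wE.
rewrite /lambertW0; case: xgetP => [v _ [_ //]|/(_ w)[]].
by split => //; rewrite (le_trans _ w0)// lerN10.
Qed.

Lemma lnV_gt0 u : 0 < u -> u < 1 -> 0 < ln (1 / u).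
Proof. by move=> u0 u1; rewrite ln_gt0// div1r invf_gt1. Qed.

Lemma powR_expR_lnV u x : 0 < u -> u `^ x = expR (- (x * ln (1 / u))).
Proof.
by move=> u0; rewrite div1r lnV// mulrN opprK /powR gt_eqF.
Qed.

Lemma mulr_lnV_le u : 0 < u -> u * ln (1 / u) <= 1 - u.
Proof.
move=> u0; have := @le_ln1Dx R (1 / u - 1).
rewrite subrKC ltrBrDr addNr divr_gt0// => /(_ isT).
rewrite -(ler_pM2l u0) mulrBr mulr1 mulrCA divff ?gt_eqF//.
by rewrite mulr1.
Qed.

(** For e = eta_c(u) the first two terms are the hazard at u, which [hazard_ge]
    bounds below by the third one. *)
Definition eta_defect a b u e := b * u - (a - e) * (1 - u) - b * u `^ e.

(** With L = ln (1 / u), c = a - b u / (1 - u) and S = c + w / L, one has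
    u^S = u^c exp (- w), and dividing the defect by 1 - u turns its vanishing
    into w / L = b u^c exp (- w) / (1 - u), which is the Lambert equation
    defining w. *)
Lemma eta_defect_Sinf a b u : 0 < b -> 0 < u -> u < 1 ->
  eta_defect a b u (Sinf a b u) = 0.
Proof.
move=> b0 u0 u1; have L0 := lnV_gt0 u0 u1.
have u10 : 0 < 1 - u by rewrite subr_gt0.
rewrite /Sinf; set L := ln _ in L0 *; set c := a - b * _.
set y := b * _ / _ * L.
have y0 : 0 < y by rewrite mulr_gt0// divr_gt0// mulr_gt0// powR_gt0.
have := lambertW0K y0; set w := lambertW0 y => wE.
have powE : u `^ (c + w / L) = u `^ c * expR (- w).
  rewrite powRD ?(gt_eqF u0) ?implybT// [u `^ (w / L)]powR_expR_lnV// -/L.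
  by rewrite divfK// gt_eqF.
have bucE : b * u `^ c = y * (1 - u) / L by rewrite /y; field; rewrite !gt_eqF.
rewrite /eta_defect powE mulrA bucE -wE expRN.
have ew := expR_gt0 w.
rewrite /c; field.
by rewrite !gt_eqF.
Qed.

Lemma eta_defect_increasing a b u e1 e2 : 0 < b -> 0 < u -> u < 1 ->
  e1 < e2 -> eta_defect a b u e1 < eta_defect a b u e2.
Proof.
move=> b0 u0 u1 e12; rewrite /eta_defect ltr_leB//.
  by rewrite ltrD2l ltrN2 ltr_pM2r ?subr_gt0// ltrD2l ltrN2.
by rewrite ler_pM2l// ger_powR ?u0 ?(ltW u1)// ltW.
Qed.

Lemma le_Sinf a b u e : 0 < b -> 0 < u -> u < 1 ->
  eta_defect a b u e <= 0 -> e <= Sinf a b u.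
Proof.
move=> b0 u0 u1 de; rewrite leNgt; apply/negP.
move=> /(eta_defect_increasing a b0 u0 u1).
by rewrite eta_defect_Sinf// ltNge de.
Qed.

Lemma Sinf_le a b u e : 0 < b -> 0 < u -> u < 1 ->
  0 <= eta_defect a b u e -> Sinf a b u <= e.
Proof.
move=> b0 u0 u1 de; rewrite leNgt; apply/negP.
move=> /(eta_defect_increasing a b0 u0 u1).
by rewrite eta_defect_Sinf// ltNge de.
Qed.

(** Factoring u out of u - u^e leaves a condition on a - e and e - 1, the two
    quantities that are simple for the S_i. *)
Lemma le_Sinf_powR a b u e : 0 < b -> 0 < u -> u < 1 ->
  b * u * (1 - u `^ (e - 1)) <= (a - e) * (1 - u) -> e <= Sinf a b u.
Proof.
move=> b0 u0 u1; rewrite -subr_le0 => de; apply: le_Sinf => //.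
rewrite (le_trans _ de)// /eta_defect powRB1//.
by rewrite le_eqVlt; apply/orP; left; apply/eqP; field; rewrite gt_eqF.
Qed.

Lemma onem_powR_le u x : 0 < u -> 1 - u `^ x <= x * ln (1 / u).
Proof.
move=> u0; rewrite powR_expR_lnV// lerBlDr -lerBlDl.
exact: expR_ge1Dx.
Qed.

Lemma Sinf_admissible a b u : 0 < b -> 0 < u -> u < 1 -> 1 <= a ->
  1 <= Sinf a b u <= a.
Proof.
move=> b0 u0 u1 a1; apply/andP; split.
  apply: le_Sinf_powR => //.
  by rewrite subrr powRr0 subrr mulr0 mulr_ge0// subr_ge0 // ltW.
apply: Sinf_le => //.
rewrite /eta_defect subrr mul0r subr0 subr_ge0 ler_pM2l// ge1r_powR//.
by rewrite u0 ltW.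
Qed.

Lemma S1_bounds a b u : 0 < b -> 0 < u -> u < 1 -> 1 <= a ->
  [/\ 1 <= S1 a b u, S1 a b u <= a & S1 a b u <= Sinf a b u].
Proof.
move=> b0 u0 u1 a1; have L0 := lnV_gt0 u0 u1.
have u10 : 0 < 1 - u by rewrite subr_gt0.
rewrite /S1; set L := ln _ in L0 *; set m := (_ - 1) / L.
have m0 : 0 < m by rewrite divr_gt0// subr_gt0 div1r invf_gt1.
have bm0 : 0 < b + m by rewrite addr_gt0.
pose s := (a - 1) / (b + m).
have s0 : 0 <= s by rewrite divr_ge0 ?subr_ge0// ltW.
have SE : a - b * s = 1 + m * s by rewrite /s; field; rewrite gt_eqF.
rewrite -/s; split.
- by rewrite SE lerDl mulr_ge0// ltW.
- by rewrite gerBl mulr_ge0// ltW.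
- apply: le_Sinf_powR => //; rewrite subKr SE [1 + _ * s]addrC addrK.
  have := onem_powR_le (m * s) u0; rewrite -/L.
  move=> /(ler_wpM2l (ltW (mulr_gt0 b0 u0))).
  move=> /le_trans; apply; rewrite le_eqVlt; apply/orP; left; apply/eqP.
  by rewrite /m; field; rewrite !gt_eqF.
Qed.

Lemma S0_bounds a b u : 0 < b -> 0 < u -> u < 1 -> 1 <= a ->
  [/\ 1 <= S0 a b u, S0 a b u <= a & S0 a b u <= Sinf a b u].
Proof.
move=> b0 u0 u1 a1; have u10 : 0 < 1 - u by rewrite subr_gt0.
rewrite /S0; set s := (a - 1) / _.
have s0 : 0 <= s by rewrite divr_ge0 ?subr_ge0// addr_ge0// ltW.
have SE : a - b * s = 1 + s by rewrite /s; field; rewrite gt_eqF// addr_gt0.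
split.
- by rewrite SE lerDl.
- by rewrite gerBl mulr_ge0// ltW.
- apply: le_Sinf_powR => //; rewrite subKr SE [1 + s]addrC addrK.
  rewrite -(mulrA b u) -(mulrA b s) ler_pM2l//.
  rewrite (le_trans (ler_wpM2l (ltW u0) (onem_powR_le s u0)))//.
  by rewrite mulrCA; apply: ler_wpM2l => //; exact: mulr_lnV_le.
Qed.

(** The derivative of (1 - y) exp (y + y^2 / 2) is - y^2 exp (y + y^2 / 2). *)
Lemma onem_expR_quadratic_le y : 0 <= y -> 1 - expR (- (y + y ^+ 2 / 2)) <= y.
Proof.
move=> y0; rewrite lerBlDl -lerBlDr expRN -div1r ler_pdivlMr ?expR_gt0//.
pose q x := x + x ^+ 2 / 2; pose f x := (1 - x) * expR (q x).
have dq x : is_derive x 1 q (1 + x).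
  have := is_deriveD (is_derive_id x 1)
    (is_deriveM (is_deriveX 2 (is_derive_id x 1))
      (is_derive_cst (2^-1 : R) x 1)).
  by move/is_derive_eq; apply; rewrite /= /GRing.scale/=; field.
suff : f y <= f 0 by rewrite {2}/f /q expr0n/= mul0r addr0 expR0 subr0 mulr1.
apply: (ler_is_derive (f' := fun x => - (x ^+ 2 * expR (q x)))) y0 => x _.
  have := is_deriveM (is_derive_onem x)
    (is_derive1_comp (f := @expR R) (g := q) (is_derive_expR (q x)) (dq x)).
  by move/is_derive_eq; apply; rewrite /= /GRing.scale/=; ring.
by rewrite oppr_le0 mulr_ge0 ?sqr_ge0 ?expR_ge0.
Qed.

(** Here S_2 = a - b z with z the nonnegative root of
    v^2 z^2 / 2 + m z = L (a - 1), where v = 1 / u - 1 and m = b L + v. The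
    equation rearranges into L (S_2 - 1) = v z + (v z)^2 / 2, so that
    u^(S_2 - 1) is exactly the exponential of [onem_expR_quadratic_le]. *)
Lemma S2_bounds a b u : 0 < b -> 0 < u -> u < 1 -> 1 <= a ->
  [/\ 1 <= S2 a b u, S2 a b u <= a & S2 a b u <= Sinf a b u].
Proof.
move=> b0 u0 u1 a1; have L0 := lnV_gt0 u0 u1.
have u10 : 0 < 1 - u by rewrite subr_gt0.
rewrite /S2; set L := ln _ in L0 *; set v := 1 / u - 1.
have v0 : 0 < v by rewrite subr_gt0 div1r invf_gt1.
have mE : b * L + 1 / u - 1 = b * L + v by rewrite addrA.
rewrite mE; set m := b * L + v.
have m0 : 0 < m by rewrite addr_gt0// mulr_gt0.
set r := Num.sqrt _; pose z := m * ((r - 1) / v ^+ 2).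
have rad0 : 0 <= 2 * v ^+ 2 * L * (a - 1) / m ^+ 2.
  apply: divr_ge0; last exact: sqr_ge0.
  apply: mulr_ge0; last by rewrite subr_ge0.
  by apply: mulr_ge0; rewrite ?(ltW L0)// mulr_ge0// sqr_ge0.
have r2 : r ^+ 2 = 1 + 2 * v ^+ 2 * L * (a - 1) / m ^+ 2.
  by rewrite sqr_sqrtr// addr_ge0.
have r1 : 1 <= r by rewrite -sqrtr1 ler_wsqrtr// lerDl.
have z0 : 0 <= z.
  by rewrite mulr_ge0 ?(ltW m0)// divr_ge0 ?sqr_ge0// subr_ge0.
have rE : r = 1 + v ^+ 2 * z / m by rewrite /z; field; rewrite !gt_eqF.
have zE : L * (a - 1 - b * z) = v * z + (v * z) ^+ 2 / 2.
  have vm0 : v ^+ 2 / m ^+ 2 != 0.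
    by rewrite mulf_neq0 ?invr_neq0 ?expf_neq0 ?gt_eqF.
  have : v ^+ 2 * z ^+ 2 + 2 * m * z - 2 * L * (a - 1) = 0.
    apply: (mulfI vm0); rewrite mulr0; transitivity
      ((1 + v ^+ 2 * z / m) ^+ 2 - (1 + 2 * v ^+ 2 * L * (a - 1) / m ^+ 2)).
      by field; rewrite gt_eqF.
    by rewrite -rE r2 subrr.
  by rewrite /m; lra.
rewrite -[b * m * _]mulrA -/z.
have vz0 : 0 <= v * z by rewrite mulr_ge0// ltW.
have slack_ge0 : 0 <= a - 1 - b * z.
  by rewrite -(pmulr_rge0 _ L0) zE addr_ge0// divr_ge0// sqr_ge0.
split.
- by lra.
- by rewrite gerBl mulr_ge0// ltW.
- apply: le_Sinf_powR => //; rewrite subKr powR_expR_lnV// -/L.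
  rewrite (_ : (a - b * z - 1) * L = v * z + (v * z) ^+ 2 / 2); last first.
    by rewrite -zE; ring.
  have := ler_wpM2l (ltW (mulr_gt0 b0 u0)) (onem_expR_quadratic_le vz0).
  move=> /le_trans; apply; rewrite le_eqVlt; apply/orP; left; apply/eqP.
  by rewrite /v; field; rewrite gt_eqF.
Qed.

Lemma S_of_admissible a b u i : 0 < a -> 0 < b -> 0 < u -> u < 1 ->
  0 <= (if 1 <= a then S_of i a b u else a) <= Num.min a (Sinf a b u).
Proof.
move=> a0 b0 u0 u1; rewrite le_min; have [a1|a1] := leP 1 a.
  suff [S1 Sa ->] : [/\ 1 <= S_of i a b u, S_of i a b u <= a
                      & S_of i a b u <= Sinf a b u].
    by rewrite Sa (le_trans ler01).
  case: i; [exact: S0_bounds|exact: S1_bounds|exact: S2_bounds|].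
  by have /andP[] := Sinf_admissible b0 u0 u1 a1.
rewrite (ltW a0) lexx /=; apply: le_Sinf => //.
rewrite /eta_defect subrr mul0r subr0 subr_le0 ler_pM2l//.
by rewrite ger1_powR ?u0 ?(ltW u1)// ltW.
Qed.

End threshold.

(** * From the law to the tail *)

Section beta_law.
Context {R : realType} (a b : R) d (T : measurableType d) (P : probability T R)
  (B : {RV P >-> R}).
Context (lawB : has_beta_law B a b).
Implicit Types (x y : R) (A : set R).

Let mu := @lebesgue_measure R.
Let f := rbeta_pdf a b.
Let c := (rbeta_fun a b)^-1.

Lemma rbeta_fun_ge0 : 0 <= rbeta_fun a b.
Proof. by apply: Rintegral_ge0 => x _; rewrite mulr_ge0// powR_ge0. Qed.

Lemma rbeta_pdf_itv x : 0 < x -> x < 1 ->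
  rbeta_pdf a b x = c * rbeta_kernel a b x.
Proof.
by move=> x0 x1; rewrite /rbeta_pdf patchE mem_set/= ?in_itv/= ?x0// mulrC.
Qed.

Lemma rbeta_pdf_out x : ~ (`]0, 1[%classic x) -> rbeta_pdf a b x = 0.
Proof. by move=> x01; rewrite /rbeta_pdf patchE memNset. Qed.

Lemma rbeta_pdf_ge0 x : 0 <= rbeta_pdf a b x.
Proof.
rewrite /rbeta_pdf patchE; case: ifP => // _.
by rewrite divr_ge0 ?rbeta_fun_ge0// mulr_ge0// powR_ge0.
Qed.

Lemma measurable_rbeta_pdf : measurable_fun [set: R] (rbeta_pdf a b).
Proof.
apply: (iffLR (measurable_restrictT _ (measurable_itv `]0, 1[))).
apply: measurable_funTS.
apply: measurable_funM => //; apply: measurable_funM => //.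
apply: (measurableT_comp (measurable_powR _)).
exact: measurable_funB.
Qed.

Let measurable_f A : measurable_fun A (EFin \o f).
Proof.
by apply: measurable_funTS; apply/measurable_EFinP; exact: measurable_rbeta_pdf.
Qed.

Let f_ge0 A x : A x -> (0 <= (f x)%:E)%E.
Proof. by move=> _; rewrite lee_fin rbeta_pdf_ge0. Qed.

Lemma integral_rbeta_pdf A : measurable A -> `]0, 1[ `<=` A ->
  (\int[mu]_(x in A) (rbeta_pdf a b x)%:E = 1)%E.
Proof.
move=> mA A01; transitivity (\int[mu]_x (f x)%:E)%E; last first.
  by rewrite -(lawB measurableT) probability_setT.
rewrite integral_mkcond; apply: eq_integral => x _; rewrite patchE.
case: ifPn => // /negP xA; rewrite /f rbeta_pdf_out// => x01.
by apply: xA; rewrite mem_set//; exact: A01.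
Qed.

Lemma beta_law_prob1 A : measurable A -> `]0, 1[ `<=` A -> P (B @^-1` A) = 1%E.
Proof. by move=> mA A01; rewrite -(integral_rbeta_pdf mA A01) -lawB. Qed.

Lemma integrable_rbeta_pdf A : measurable A -> mu.-integrable A (EFin \o f).
Proof.
move=> mA; apply: (integrableS measurableT) => //.
apply/integrableP; split; first exact: measurable_f.
under eq_integral do rewrite /= ger0_norm ?rbeta_pdf_ge0//.
by rewrite integral_rbeta_pdf// ltry.
Qed.

(** A null or infinite normalising integral would make the density vanish
    identically, since the real-valued integral and the inverse are then 0;
    the total mass 1 of the law excludes this. *)
Lemma rbeta_fun_inv_gt0 : 0 < c.
Proof.
rewrite lt_neqAle invr_ge0 rbeta_fun_ge0 andbT eq_sym.
apply/negP => /eqP c0; have := integral_rbeta_pdf measurableT (@subsetT _ _).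
rewrite integral0_eq => [/eqP|x _]; first by rewrite eq_sym onee_eq0.
rewrite /rbeta_pdf patchE; case: ifP => // _.
by rewrite -/c c0 mulr0.
Qed.

Let tail x := fine (P [set t | x <= B t]).

Let F x := parameterized_integral mu 0 x f.

(* The tail is written as the complement of an integral starting at 0 because
   the fundamental theorem of calculus is available for a variable upper
   bound. *)
Let tailE x : 0 <= x -> tail x = 1 - F x.
Proof.
move=> x0.
have PE : P [set t | x <= B t] = (\int[mu]_(y in `[x, +oo[) (f y)%:E)%E.
  rewrite -lawB// /distribution /pushforward; congr (P _).
  by apply/seteqP; split=> t /=; rewrite in_itv/= andbT.
have : (\int[mu]_(y in `[0%R, +oo[) (f y)%:E = 1)%E.
  apply: integral_rbeta_pdf => //; apply: subset_itv; rewrite bnd_simp//.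
rewrite (@itv_bndbnd_setU _ _ _ (BLeft x))//=.
rewrite ge0_integral_setU//=; last 3 first.
- exact: measurable_f.
- exact: f_ge0.
- apply/disj_set2P; rewrite -subset0 => z/=; rewrite !in_itv/= => -[/andP[_]].
  by rewrite ltNge => /negbTE ->.
rewrite integral_itv_bndo_bndc => [sum1|]; last exact: measurable_f.
apply/eqP; rewrite eq_sym subr_eq eq_sym.
rewrite /F /parameterized_integral /Rintegral /tail PE addrC.
rewrite -fineD; last 2 first.
- by apply: integrable_fin_num => //; exact: integrable_rbeta_pdf.
- by apply: integrable_fin_num => //; exact: integrable_rbeta_pdf.
by rewrite sum1.
Qed.

Let f_continuous x : 0 < x -> x < 1 -> {for x, continuous f}.
Proof.
move=> x0 x1.
have ck : {for x, continuous (fun y => c * rbeta_kernel a b y)}.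
  have [+ _] := is_deriveZ c (is_derive_rbeta_kernel a b x0 x1).
  by move=> /derivable1_diffP/differentiable_continuous.
have fE : \near x, c * rbeta_kernel a b x = f x.
  near=> y; rewrite /f rbeta_pdf_itv//; near: y.
    exact: lt_nbhsr.
  exact: lt_nbhsl.
rewrite /prop_for /continuous_at -(nbhs_singleton fE).
by apply: cvg_trans ck; exact: near_eq_cvg.
Unshelve. all: by end_near. Qed.

Lemma beta_law_tail : beta_tail c a b (fun x => fine (P [set t | x <= B t])).
Proof.
split=> [x x0 x1|].
  have [dF F'] := @continuous_FTC1_closed R f 0 x 1 x1
    (integrable_rbeta_pdf (measurable_itv _)) x0 (f_continuous x0 x1).
  have dFx : is_derive x 1 F (f x).
    by apply: DeriveDef; [exact: dF|rewrite -derive1E; exact: F'].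
  have tailF : \near x, 1 - F x = tail x.
    by near=> y; rewrite tailE// ltW//; near: y; exact: lt_nbhsr.
  apply: (near_eq_is_derive tailF); rewrite -rbeta_pdf_itv// -sub0r.
  exact: (is_deriveB (is_derive_cst (1 : R) x 1) dFx).
have F1 : F 1 = 1.
  rewrite /F /parameterized_integral /Rintegral integral_rbeta_pdf//.
  exact: subset_itv_oo_cc.
have : 1 - F x @[x --> (1 : R)^'-] --> 1 - F 1.
  apply: cvgB; first exact: cvg_cst.
  apply: parameterized_integral_cvg_at_left => //.
  exact: integrable_rbeta_pdf.
rewrite F1 subrr; apply: cvg_trans; apply: near_eq_cvg; near=> x.
by rewrite -tailE//; near: x; exact: nbhs_left_ge.
Unshelve. all: by end_near. Qed.

End beta_law.

(** * The relative entropy bound *)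

Section kl.
Context {R : realType}.
Implicit Types p q : R.

Lemma klE p q : 0 < p -> p < 1 -> 0 < q -> q < 1 ->
  kl p q = (p * ln (p / q) + (1 - p) * ln ((1 - p) / (1 - q)))%:E.
Proof. by move=> *; rewrite /kl /kl_term !gt_eqF ?subr_gt0. Qed.

Lemma kl0 q : q < 1 -> kl 0 q = (- ln (1 - q))%:E.
Proof.
move=> q1; rewrite /kl /kl_term eqxx subr0 oner_eq0 gt_eqF ?subr_gt0//.
by rewrite add0e mul1r div1r lnV// posrE subr_gt0.
Qed.

End kl.

Section admissible_eta.
Context {R : realType} (a b u eta : R).
Context (b_gt0 : 0 < b) (u_gt0 : 0 < u) (u_lt1 : u < 1).
Context (eta_le_a : eta <= a) (eta_le_Sinf : eta <= Sinf a b u).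

Lemma Sinf_le_critical_eta c H : 0 < c -> beta_tail c a b H -> 1 <= a ->
  Sinf a b u <= critical_eta c a b H u.
Proof.
move=> c0 tailH a1; apply: Sinf_le => //.
by rewrite /eta_defect -hazardE// subr_ge0 hazard_ge.
Qed.

Lemma eta_le_critical_eta c H x : 0 < c -> beta_tail c a b H ->
  0 < x -> x <= u -> eta <= critical_eta c a b H x.
Proof.
move=> c0 tailH x0 xu; have x1 := le_lt_trans xu u_lt1.
have [a1|a1] := leP a 1.
  by rewrite (le_trans eta_le_a)// critical_eta_ge_a.
rewrite (le_trans eta_le_Sinf)//.
rewrite (le_trans (Sinf_le_critical_eta c0 tailH (ltW a1)))//.
by rewrite critical_eta_nonincreasing// ltW.
Qed.

Context d (T : measurableType d) (P : probability T R) (B : {RV P >-> R}).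
Context (lawB : has_beta_law B a b).

Let H x := fine (P [set t | x <= B t]).

Lemma beta_law_tail_gt0 x : 0 < x -> x < 1 -> 0 < H x.
Proof.
exact: (beta_tail_gt0 (rbeta_fun_inv_gt0 lawB) (beta_law_tail lawB)).
Qed.

Let measurable_tail (x : R) : measurable [set t | x <= B t].
Proof.
rewrite (_ : [set t | _] = B @^-1` `[x, +oo[); last first.
  by apply/seteqP; split=> t /=; rewrite in_itv/= andbT.
by rewrite -[X in measurable X]setTI; exact: measurable_funP.
Qed.

Let tailE (x : R) : P [set t | x <= B t] = (H x)%:E.
Proof. by rewrite fineK// fin_num_measure. Qed.

Let tail_le1 (x : R) : H x <= 1.
Proof. by rewrite -lee_fin -tailE probability_le1. Qed.

Lemma beta_law_ln_tail_le x : 0 < x -> x <= u ->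
  ln (H u) - ln (H x)
    <= (a - eta) * (ln u - ln x) + b * (ln (1 - u) - ln (1 - x)).
Proof.
move=> x0 xu.
have c0 := rbeta_fun_inv_gt0 lawB; have tailH := beta_law_tail lawB.
by apply: (beta_tail_ln_le c0 tailH) => // z; exact: eta_le_critical_eta.
Qed.

(** The case p = 0 is reached as a limit: for small x > 0 the tail at x is at
    most 1 and b ln (1 - x) is negligible. *)
Lemma beta_law_ln_tail_le0 : eta = a -> ln (H u) <= b * ln (1 - u).
Proof.
move=> etaa; apply/ler_addgt0Pl => e e0.
(* chosen so that - b ln (1 - x) <= e *)
pose x := Num.min u (1 - expR (- (e / b))).
have x0 : 0 < x.
  by rewrite lt_min u_gt0 subr_gt0 expR_lt1 oppr_lt0 divr_gt0.
have xu : x <= u by rewrite ge_min lexx.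
have x1 := le_lt_trans xu u_lt1.
have := beta_law_ln_tail_le x0 xu; rewrite etaa subrr mul0r add0r.
have := ln_le0 (tail_le1 x).
have : - (e / b) <= ln (1 - x).
  rewrite -[leLHS]expRK ler_ln ?posrE ?expR_gt0 ?subr_gt0//.
  by rewrite lerBrDl -lerBrDr ge_min lexx orbT.
rewrite -mulNr ler_pdivrMr//.
lra.
Qed.

Lemma beta_law_tail_kl :
  (a - eta) / (a + b - eta) < u ->
  (lne (P [set t | (u <= B t)%R])
     - lne (P [set t | ((a - eta) / (a + b - eta) <= B t)%R])
   <= - ((a + b - eta)%:E * kl ((a - eta) / (a + b - eta)) u))%E.
Proof.
have n0 : 0 < a + b - eta by rewrite addrAC ltr_wpDl// subr_ge0.
set n := a + b - eta in n0 *; set p := (a - eta) / n => pu.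
have pn : n * p = a - eta by rewrite /p mulrC divfK// gt_eqF.
have qn : n * (1 - p) = b by rewrite mulrBr mulr1 pn /n; ring.
have p0 : 0 <= p by rewrite divr_ge0 ?(ltW n0)// subr_ge0.
clearbody p; have Hu := beta_law_tail_gt0 u_gt0 u_lt1.
rewrite (tailE u) lne_EFin//; move: p0; rewrite le_eqVlt => /predU1P[p0|p0].
  have etaa : eta = a.
    by move/eqP: pn; rewrite -p0 mulr0 eq_sym subr_eq0 => /eqP.
  have -> : P [set t | p <= B t] = 1%E.
    rewrite -p0 (_ : [set t | _] = B @^-1` `[0, +oo[); last first.
      by apply/seteqP; split=> t /=; rewrite in_itv/= andbT.
    by apply: (beta_law_prob1 lawB) => //; apply: subset_itv; rewrite bnd_simp.
  rewrite lne1 sube0 -p0 kl0// -EFinM -EFinN lee_fin mulrN opprK.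
  rewrite (le_trans (beta_law_ln_tail_le0 etaa))//.
  by rewrite -[in leLHS]qn -p0 subr0 mulr1.
have p1 := lt_trans pu u_lt1.
have Hp := beta_law_tail_gt0 p0 p1.
rewrite (tailE p) lne_EFin// klE// -EFinB -EFinM -EFinN lee_fin.
rewrite (le_trans (beta_law_ln_tail_le p0 (ltW pu)))//.
rewrite !ln_div ?posrE ?subr_gt0// -[X in X * (ln u - _)]pn.
rewrite -[X in X * (ln (1 - u) - _)]qn le_eqVlt; apply/orP; left; apply/eqP.
by ring.
Qed.

End admissible_eta.

Theorem lemma3p1 (R : realType) (a b u : R)
    (a_gt0 : 0 < a) (b_gt0 : 0 < b) (u_gt0 : 0 < u) (u_lt1 : u < 1) :
  (forall eta : R, 0 <= eta <= Num.min a (Sinf a b u) ->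
    forall (d : measure_display) (T : measurableType d) (P : probability T R)
      (B : {RV P >-> R}), has_beta_law B a b ->
    (a - eta) / (a + b - eta) < u ->
    (lne (P [set t | (u <= B t)%R])
       - lne (P [set t | ((a - eta) / (a + b - eta) <= B t)%R])
     <= - ((a + b - eta)%:E * kl ((a - eta) / (a + b - eta)) u))%E)
  /\
  (forall i : S_index,
     0 <= (if 1 <= a then S_of i a b u else a) <= Num.min a (Sinf a b u)).
Proof.
split=> [eta|i]; last exact: S_of_admissible.
rewrite le_min => /and3P[_ eta_le_a eta_le_Sinf] d T P B lawB.
exact: beta_law_tail_kl.
Qed.
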